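(* Let $G$ be a connected locally maximal 1-plane graph, and let $k$ be a positive integer. Then $G$ has a separating set of size at most $k$ if and only if the radial planarisation $\Lambda(G)$ has a constrained separating cycle of length at most $2k$.
   Context: All graphs are loopless; parallel edges are allowed. A drawing of a graph in the plane maps vertices to distinct points and edges to simple arcs between their endpoints; drawings are assumed good: any two edges meet at most once, either at a common endpoint or at a crossing in their interiors, so each crossing (a pair of edges intersecting at a point that is not a vertex) has four distinct endpoints. A 1-planar drawing is one in which every edge is crossed at most once. The planarisation $G^\times$ is obtained by placing a dummy vertex at each crossing point, yielding a plane graph; a 1-plane graph is a graph together with a fixed 1-planar drawing (equivalently, the embedding of its planarisation). A 1-plane graph is locally maximal if for every crossing $\{(u,v),(w,x)\}$, the four endpoints $u,v,w,x$ induce a complete graph $K_4$ in $G$. The radial graph $R(G)$ is obtained from the plane graph $G^\times$ by placing a face vertex inside each face of $G^\times$ and connecting it, for each angle of that face, to the vertex at that angle (an angle at $v$ is a pair of consecutive edges in the clockwise rotation at $v$); the radial planarisation $\Lambda(G)$ is the plane (multi)graph $G^\times \cup R(G)$, where each edge of $R(G)$ is drawn bisecting its corresponding angle of $G^\times$. Cycles in $\Lambda(G)$ may have length 2 (two parallel edges). A separating set of a connected graph $G$ is a set $S\subseteq V(G)$ such that $G-S$ is disconnected; the connected components are called flaps. A cycle $X$ of $\Lambda(G)$ is a constrained separating cycle if (1) $\Lambda(G)\setminus X$ has at least two connected components that contain vertices of $G$; (2) $X$ is a subgraph of $R(G)$; (3) $X$ contains no dummy vertices. *)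

(* Defs.v *)
From HB Require Import structures.
From mathcomp Require Import all_boot all_fingroup.

Set Implicit Arguments.
Unset Strict Implicit.
Unset Printing Implicit Defensive.

(* Loopless finite multigraphs; an edge is a label carrying a 2-element set of
   endpoints, so distinct labels may be parallel. *)
Record mgraph := MGraph {
  vertex : finType;
  edge : finType;
  ends : edge -> {set vertex};
  card_ends : forall e, #|ends e| = 2
}.

Definition adj (G : mgraph) : rel (vertex G) :=
  [rel x y | [exists e : edge G, ends e == [set x; y]]].

Definition adj_minus (G : mgraph) (S : {set vertex G}) : rel (vertex G) :=
  [rel x y | [&& x \notin S, y \notin S & adj x y]].

(* The vertex sets of the connected components of G - S. *)
Definition components (G : mgraph) (S : {set vertex G}) :
    {set {set vertex G}} :=
  [set [set y | connect (adj_minus S) x y] | x in ~: S].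

Definition connected (G : mgraph) : Prop := #|components (set0 : {set vertex G})| = 1.

Definition separating (G : mgraph) (S : {set vertex G}) : Prop :=
  1 < #|components S|.

(* A cycle v_0 e_0 v_1 e_1 ... v_(n-1) e_(n-1) v_0, given as the sequence of the
   pairs (v_i, e_i).  Two parallel edges form a cycle of length 2, whence the
   explicit condition that the edges are distinct. *)
Definition is_cycle (H : mgraph) (c : seq (vertex H * edge H)) : Prop :=
  [/\ 1 < size c,
      path.cycle (fun p q => ends p.2 == [set p.1; q.1]) c,
      uniq [seq p.1 | p <- c]
    & uniq [seq p.2 | p <- c]].

Definition cycle_vertices (H : mgraph) (c : seq (vertex H * edge H)) :
    {set vertex H} := [set v in [seq p.1 | p <- c]].

(* Combinatorial embedding of a loopless multigraph with vertex set V: every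
   edge is split into two darts exchanged by rev, and nxt sends a dart to the
   next one in the clockwise rotation at its tail. *)
Record rotation_system (V : finType) := RotationSystem {
  dart : finType;
  tail : dart -> V;
  rev : {perm dart};
  nxt : {perm dart};
  revK : involutive rev;
  tail_rev : forall d, tail (rev d) != tail d;
  tail_nxt : forall d d', (tail d == tail d') = (d' \in porbit nxt d)
}.

Section RotationSystem.
Variables (V : finType) (M : rotation_system V).

Definition map_edge : finType := {A : {set dart M} | A \in porbits (rev M)}.

Definition map_ends (A : map_edge) : {set V} := [set tail d | d in val A].

Lemma card_map_ends A : #|map_ends A| = 2.
Proof.
rewrite /map_ends; case: A => A /= /imsetP[d _ {A}->].
have -> : porbit (rev M) d = [set d; rev M d].
  apply/setP => d'; rewrite !inE; apply/porbitP/orP => [[i ->]|[] /eqP ->].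
  - rewrite permX; elim: i => [|i [] /eqP IHi] /=; first by left.
    + by right; rewrite IHi.
    + by left; rewrite IHi revK.
  - by exists 0; rewrite expg0 perm1.
  - by exists 1; rewrite expg1.
by rewrite imsetU1 imset_set1 cards2 eq_sym tail_rev.
Qed.

Definition map_graph : mgraph := MGraph card_map_ends.

(* The angle between a dart d and nxt d is indexed by d.  The angle that
   follows it along the boundary of its face is the one indexed by
   rev (nxt d), so faces are the orbits of (nxt * rev)%g (perm composition is
   from left to right).  A component reduced to an isolated vertex
   has one face and no angle. *)
Definition face : finType :=
  ({A : {set dart M} | A \in porbits (nxt M * rev M)%g}
   + {v : V | v \notin codom (@tail V M)})%type.

Lemma angle_face_subproof (d : dart M) :
  porbit (nxt M * rev M)%g d \in porbits (nxt M * rev M)%g.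
Proof. exact: imset_f. Qed.

Definition angle_face (d : dart M) : face :=
  inl (exist _ (porbit (nxt M * rev M)%g d) (angle_face_subproof d)).

(* Genus 0, by Euler's formula V - E + F = 2C, where each component is taken on
   a sphere of its own.  For a connected graph this is exactly an embedding in
   the plane up to homeomorphism of the sphere; for a disconnected graph
   the relative position of the components is not recorded. *)
Definition planar : Prop :=
  #|V| + #|face|
  = #|map_edge| + 2 * #|components (set0 : {set vertex map_graph})|.

Definition radial_vertex : finType := (V + face)%type.

(* The edges of the embedded graph, and one radial edge per angle. *)
Definition radial_edge : finType := (map_edge + dart M)%type.

Definition radial_ends (e : radial_edge) : {set radial_vertex} :=
  match e with
  | inl A => [set inl v | v in map_ends A]
  | inr d => [set inl (tail d); inr (angle_face d)]
  end.

Lemma card_radial_ends e : #|radial_ends e| = 2.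
Proof.
case: e => [A|d] /=; last by rewrite cards2.
by rewrite card_imset ?card_map_ends // => x y [].
Qed.

Definition with_radial : mgraph := MGraph card_radial_ends.

End RotationSystem.

(* A good 1-planar drawing of G, given by the embedding of the planarisation,
   whose vertices are those of G and one dummy vertex per crossing; seg d is
   the edge of G of which the dart d is (part of) a segment. *)
Record one_planar_drawing (G : mgraph) := OnePlanarDrawing {
  crossing : finType;
  planarisation : rotation_system (vertex G + crossing)%type;
  planarisation_planar : planar planarisation;
  seg : dart planarisation -> edge G;
  seg_rev : forall d, seg (rev planarisation d) = seg d;
  (* each edge has exactly one dart at each of its endpoints, and no dart at
     any other vertex of G *)
  seg_ends : forall (e : edge G) (v : vertex G),
    #|[set d | (seg d == e) && (tail d == inl v)]| = (v \in ends e);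
  crossing_degree : forall x : crossing,
    #|[set d : dart planarisation | tail d == inr x]| = 4;
  (* two distinct edges alternate around each crossing *)
  crossing_alternate : forall (d : dart planarisation) (x : crossing),
    tail d = inr x ->
    seg (nxt planarisation d) != seg d /\
    seg (nxt planarisation (nxt planarisation d)) = seg d;
  crossed_once : forall (d d' : dart planarisation) (x y : crossing),
    seg d = seg d' -> tail d = inr x -> tail d' = inr y -> x = y;
  crossing_good : forall (d d' : dart planarisation) (x : crossing),
    tail d = inr x -> tail d' = inr x -> seg d != seg d' ->
    [disjoint ends (seg d) & ends (seg d')]
}.

Section OnePlane.
Variables (G : mgraph) (D : one_planar_drawing G).

Definition passes (e : edge G) (x : crossing D) : Prop :=
  exists d : dart (planarisation D), seg d = e /\ tail d = inr x.

Definition cross (e f : edge G) : Prop :=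
  e != f /\ exists x, passes e x /\ passes f x.

(* "Induce a K_4" is read up to parallel edges. *)
Definition locally_maximal : Prop :=
  forall e f : edge G, cross e f ->
  forall u v : vertex G,
    u \in ends e :|: ends f -> v \in ends e :|: ends f -> u != v -> adj u v.

Definition radial_planarisation : mgraph := with_radial (planarisation D).

Definition real_vertex (v : vertex G) : vertex radial_planarisation :=
  inl (inl v).

Definition dummy_vertex (x : crossing D) : vertex radial_planarisation :=
  inl (inr x).

Definition angle_edge (a : dart (planarisation D)) :
    edge radial_planarisation := inr a.

Definition constrained_separating_cycle
    (c : seq (vertex radial_planarisation * edge radial_planarisation)) :
    Prop :=
  [/\ is_cycle c,
      1 < #|[set C in components (cycle_vertices c) |
             [exists v : vertex G, real_vertex v \in C]]|,
      forall p, p \in c -> exists a, p.2 = angle_edge a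
    & forall x : crossing D, dummy_vertex x \notin cycle_vertices c].

End OnePlane.

(* Main.v *)
(* A constrained separating cycle meets the vertices of G in a set S of half its
   length, and a path of G - S is drawn in the planarisation without meeting the
   cycle, since the crossings it goes through are not on the cycle.

   Conversely, let A be one flap of a separating set S.  Local maximality puts
   the non-S ends of two crossing edges in one flap, so A extends to a
   set of vertices of the planarisation whose only neighbours outside it lie in
   S.  Colouring the edges of the planarisation that touch this set, the
   angles where the colour changes are all at vertices of S and form a subgraph
   of the radial graph with even degrees.  In a planar map every even subgraph of
   the radial graph arises from a 2-colouring of the edges: over the field with
   two elements, Euler's formula gives both spaces dimension E - 1.  Hence every
   cycle of that subgraph has two sides, and as their sum separates A from the
   other flaps, one of these cycles does. *)

From mathcomp Require Import all_boot all_fingroup all_algebra zify.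
Require Import Defs.

Set Implicit Arguments.
Unset Strict Implicit.
Unset Printing Implicit Defensive.

Import GRing.Theory.

(** * Linear algebra over the field with two elements *)

(** The left kernel lies in the line spanned by the all-ones vector, so rank-nullity leaves a defect
    of at most one. The field is [bool], with [addb] as addition. *)
Lemma rank_kermx_const m n (A : 'M[bool]_(m, n)) :
  (forall u : 'rV_m, (u *m A = 0)%R -> forall i j, u ord0 i = u ord0 j) ->
  m.-1 <= \rank A.
Proof.
case: m A => [|m] A constA //=.
have sub1 : (kermx A <= (const_mx 1%R : 'rV_m.+1))%MS.
  apply/rV_subP => u /sub_kermxP uA0; apply/submxP; exists (u ord0 ord0)%:M%R.
  apply/rowP => i; rewrite mul_scalar_mx !mxE mulr1.
  exact: constA.
have := leq_trans (mxrankS sub1) (rank_leq_row _).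
by rewrite mxrank_ker leq_subLR addn1 ltnS.
Qed.

(** * Cycles in multigraphs *)

Section Cycles.
Variable H : mgraph.
Implicit Types (c : seq (vertex H * edge H)) (e : edge H) (v w : vertex H).

Definition next_on (p q : vertex H * edge H) : bool := ends p.2 == [set p.1; q.1].

Lemma ends_neq e v w : ends e = [set v; w] -> v != w.
Proof. by move=> ee; have := card_ends e; rewrite ee cards2; case: eqP. Qed.

Lemma ends_other e v : v \in ends e -> exists w, ends e = [set v; w].
Proof.
move=> ve; have /cards2P[x [y [_ exy]]] : #|ends e| == 2 by rewrite card_ends.
by move: ve; rewrite exy => /set2P[->|->]; [exists y | exists x; rewrite [RHS]setUC].
Qed.

Lemma ends_pair e v w : v \in ends e -> w \in ends e -> v != w -> ends e = [set v; w].
Proof.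
by move=> /ends_other[x ->] /set2P[->|-> //]; rewrite eqxx.
Qed.

Lemma adj_sym : symmetric (@adj H).
Proof. by move=> v w; apply: eq_existsb => e; rewrite setUC. Qed.

Lemma connect_adj_minus_sym (S : {set vertex H}) : connect_sym (adj_minus S).
Proof.
apply: sym_connect_sym => v w.
by rewrite /adj_minus [LHS]/= [in LHS]adj_sym andbCA.
Qed.

(** The predicate [P] makes one statement serve both notions of separation: it is trivial for
    separating sets, and asks for a real vertex in the case of constrained cycles. *)
Lemma components_gt1 (S : {set vertex H}) (P : pred {set vertex H}) :
  reflect (exists v w, [/\ [/\ v \notin S, w \notin S & ~~ connect (adj_minus S) v w],
                           P [set x | connect (adj_minus S) v x]
                         & P [set x | connect (adj_minus S) w x]])
          (1 < #|[set C in components S | P C]|).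
Proof.
apply: (iffP card_gt1P) => [[A [B []]]|[v [w [[vS wS nvw] Pv Pw]]]].
  rewrite !inE => /andP[/imsetP[v vS ->] Pv] /andP[/imsetP[w wS ->] Pw] ne.
  rewrite !inE in vS wS; exists v, w; split=> //; split=> //.
  apply: contraNN ne => vw; apply/eqP/setP => x; rewrite !inE.
  exact: same_connect (connect_adj_minus_sym S) _ _ vw x.
exists [set x | connect (adj_minus S) v x], [set x | connect (adj_minus S) w x].
rewrite !inE Pv Pw !imset_f ?inE //; split=> //.
by apply: contraNneq nvw => /setP/(_ w); rewrite !inE connect0.
Qed.

Lemma separatingP (S : {set vertex H}) :
  separating S <->
  exists v w, [/\ v \notin S, w \notin S & ~~ connect (adj_minus S) v w].
Proof.
have -> : separating S <-> 1 < #|[set C in components S | predT C]|.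
  rewrite /separating.
  suff -> : [set C in components S | predT C] = components S by [].
  by apply/setP => C; rewrite !inE andbT.
split=> [/components_gt1[v [w [vw _ _]]]|[v [w vw]]]; first by exists v, w.
by apply/components_gt1; exists v, w.
Qed.

Lemma connectedP : connected H -> forall v w, connect (adj_minus set0) v w.
Proof.
move=> H1 v w; apply/negPn/negP => nvw.
have : separating (set0 : {set vertex H}).
  by apply/separatingP; exists v, w; rewrite !inE.
by rewrite /separating H1.
Qed.

Lemma cycle_end_mem c p w :
  is_cycle c -> p \in c -> w \in ends p.2 -> w \in cycle_vertices c.
Proof.
move=> [_ cc _ _] pc; have /eqP -> := next_cycle cc pc.
by case/set2P => ->; rewrite inE map_f ?mem_next.
Qed.

Lemma cycle_even c w : is_cycle c -> \big[addb/false]_(p <- c) (w \in ends p.2) = false.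
Proof.
(* Modulo 2 the incidences with [w] telescope to the two ends of a path, which coincide once the
   path is closed. *)
have pathE p s : path next_on p s ->
    \big[addb/false]_(q <- belast p s) (w \in ends q.2)
    = (w == p.1) (+) (w == (last p s).1).
  elim: s p => [|q s IHs] p /=; first by rewrite big_nil addbb.
  case/andP=> /eqP pq /IHs; rewrite big_cons pq !inE => ->.
  have := ends_neq pq; have [->|_ _] := eqVneq w p.1; last first.
    by rewrite orFb addbA addbb.
  by move=> /negbTE ->.
case=> + + _ _; case: c => //= p s _ /pathE.
by rewrite belast_rcons last_rcons addbb.
Qed.

(* Along a non-backtracking walk inside [z], the segment between the first
   repeated vertex and its earlier occurrence is a cycle. *)
Lemma exists_cycle (z : pred (edge H)) :
  (forall v e, z e -> v \in ends e ->
     exists e', [/\ z e', v \in ends e' & e' != e]) ->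
  (exists e, z e) ->
  exists2 c, is_cycle c & forall p, p \in c -> z p.2.
Proof.
move=> zdeg [e0 ze0].
pose good (p : vertex H * edge H) := z p.2 && (p.1 \in ends p.2).
(* The default [p] is never taken on good pairs, since [zdeg] always provides a continuation along a
   different edge. *)
pose f p := odflt p [pick q | [&& good q, next_on p q & q.2 != p.2]].
have fP p : good p -> [/\ good (f p), next_on p (f p) & (f p).2 != p.2].
  case/andP=> zp /ends_other[w ew]; rewrite /f; case: pickP => [q /and3P[gq pq nq]|no].
    by split.
  have wp : w \in ends p.2 by rewrite ew set22.
  have [e' [ze' we' ne']] := zdeg w p.2 zp wp.
  by have := no (w, e'); rewrite /good /next_on /= ze' we' ew eqxx ne'.
have [v0 v0e] : exists v0, v0 \in ends e0.
  by apply/card_gt0P; rewrite card_ends.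
pose x i := iter i f (v0, e0).
have gx i : good (x i).
  by elim: i => [|i /fP[]]; rewrite /good /= ?ze0.
have xS i : ends (x i).2 = [set (x i).1; (x i.+1).1] by case: (fP _ (gx i)) => _ /eqP.
have xN i : (x i.+1).2 != (x i).2 by case: (fP _ (gx i)).
have exP : exists j, [exists i : 'I_j, (x i).1 == (x j).1].
  have /injectivePn[i [j nij eij]] :
      ~~ injectiveb (fun i : 'I_#|vertex H|.+1 => (x i).1).
    apply: contraTN isT => /injectiveP/leq_card; rewrite card_ord.
    by rewrite ltnn.
  wlog ltij : i j nij eij / i < j => [hw|].
    have := nij; rewrite -(inj_eq val_inj) neq_ltn => /orP[|] lt; last first.
      rewrite eq_sym in nij.
      exact: hw nij (esym eij) lt.
    exact: hw lt.
  by exists j; apply/existsP; exists (Ordinal ltij); apply/eqP.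
(* Taking the first repetition [j] makes all vertices before it pairwise distinct. *)
case: (ex_minnP exP) => j /existsP[[i /= ij] /eqP eij] minj {exP}.
have x_inj l m : l < m -> m < j -> (x l).1 <> (x m).1.
  move=> lm mj e; have := minj m; rewrite leqNgt mj => /(_ _)/negP; apply => //.
  by apply/existsP; exists (Ordinal lm); apply/eqP.
pose c := [seq x l | l <- iota i (j - i)].
have uniqc (T : eqType) (h : vertex H * edge H -> T) :
    (forall l m, i <= l -> l < m -> m < j -> h (x l) <> h (x m)) ->
    uniq [seq h p | p <- c].
  move=> hinj; rewrite -map_comp map_inj_in_uniq ?iota_uniq // => l m.
  rewrite !mem_iota subnKC ?(ltnW ij) // => /andP[il lj] /andP[im mj] /= e.
  by case: (ltngtP l m) => // lm; [case: (hinj l m) | case: (hinj m l)].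
exists c; last first.
  by move=> p /mapP[l _ ->]; case/andP: (gx l).
split.
- rewrite size_map size_iota ltn_subRL addn1 ltn_neqAle ij andbT.
  (* If [j] were [i + 1], the edge of [x i] would be a loop. *)
  by apply: contraTneq (ends_neq (xS i)) => ->; rewrite eij eqxx.
- have pathx n l : path next_on (x l) [seq x m | m <- iota l.+1 n].
    by elim: n l => // n IHn l; apply/andP; split; [rewrite /next_on xS | exact: IHn].
  have jE : i.+1 + (j - i).-1 = j by rewrite addSnnS prednK ?subn_gt0 // subnKC // ltnW.
  rewrite /c -[j - i]prednK ?subn_gt0 //=.
  have := pathx ((j - i).-1 + 1) i; rewrite iotaD jE map_cat cats1 !rcons_path.
  by rewrite /next_on eij.
- by apply: uniqc => l m _; apply: x_inj.
- apply: uniqc => l m _ lm mj e.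
  (* Equal edges at [l < m] make the vertex at [m] the one at [l] or at [l + 1]: either a vertex
     repeats before [j], or [m = l + 1] and the walk backtracks. *)
  have /set2P[eml|eml] : (x m).1 \in [set (x l).1; (x l.+1).1].
    by rewrite -xS e xS set21.
    exact: (x_inj l m).
  have [lm1|ml|lm1] := ltngtP l.+1 m.
  + exact: (x_inj _ _ lm1 mj (esym eml)).
  + by move: ml; rewrite ltnS leqNgt lm.
  + by move: (xN l); rewrite e -lm1 eqxx.
Qed.

End Cycles.

(** One step along the cycle exchanges [P] and its complement, so the two are counted equally
    often. *)
Lemma size_cycle_alternate (T : eqType) (r : rel T) (P : pred T) (c : seq T) :
  {in c, forall p q, r p q -> P q = ~~ P p} -> path.cycle r c ->
  size c = 2 * count P c.
Proof.
move=> alt cc; rewrite mul2n -addnn -[LHS](count_predC P); congr (_ + _).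
have pathE p s : {in belast p s, forall p q, r p q -> P q = ~~ P p} ->
    path r p s -> count (predC P) (belast p s) = count P s.
  elim: s p => //= q s IHs p alts /andP[pq qs].
  rewrite (alts p _ q pq) ?mem_head // IHs // => t ts.
  by apply: alts; rewrite inE ts orbT.
case: c alt cc => // p s alt cc; have := pathE _ _ _ cc.
rewrite belast_rcons => /(_ alt) ->.
by rewrite -cats1 count_cat /= addn0 addnC.
Qed.

(** * Even subgraphs of the radial graph of a planar map *)

Section Jordan.
Variables (V : finType) (M : rotation_system V).

Lemma edge_of_subproof (d : dart M) : porbit (rev M) d \in porbits (rev M).
Proof. exact: imset_f. Qed.

Definition edge_of (d : dart M) : map_edge M :=
  exist _ (porbit (rev M) d) (edge_of_subproof d).

Lemma edge_ofE (A : map_edge M) d : (d \in val A) = (A == edge_of d).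
Proof.
rewrite -val_eqE /=; case: A => A /= /imsetP[d' _ ->].
by rewrite eq_porbit_mem porbit_sym.
Qed.

Lemma edge_of_rev d : edge_of (rev M d) = edge_of d.
Proof. by apply: val_inj; rewrite /= -[in LHS](expg1 (rev M)) porbit_perm. Qed.

Lemma edge_of_surj A : exists d, A = edge_of d.
Proof.
by have /imsetP[d _ Ad] := valP A; exists d; apply: val_inj.
Qed.

Lemma edge_ofP d d' : reflect (d' = d \/ d' = rev M d) (d' \in porbit (rev M) d).
Proof.
apply: (iffP (porbitP _ _ _)) => [[i ->]|[] ->].
- rewrite permX; elim: i => [|i [] IHi] /=; first by left.
  + by right; rewrite IHi.
  + by left; rewrite IHi revK.
- by exists 0; rewrite expg0 perm1.
- by exists 1; rewrite expg1.
Qed.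

Lemma map_ends_edge_of d : map_ends (edge_of d) = [set tail d; tail (rev M d)].
Proof.
apply/setP => v; rewrite !inE; apply/imsetP/orP => [[d' /edge_ofP[] -> ->]|[] /eqP->].
- by left.
- by right.
- by exists d => //; apply/edge_ofP; left.
- by exists (rev M d) => //; apply/edge_ofP; right.
Qed.

Lemma tail_nxt_eq (d : dart M) : tail (nxt M d) = tail d.
Proof. by apply/esym/eqP; rewrite tail_nxt -{1}(expg1 (nxt M)) mem_porbit. Qed.

Lemma angle_face_next d : angle_face (rev M (nxt M d)) = angle_face d.
Proof.
congr inl; apply: val_inj => /=.
by rewrite -permM -[in LHS](expg1 (nxt M * rev M)%g) porbit_perm.
Qed.

Lemma orbit_invariant T (p : {perm dart M}) (g : dart M -> T) :
  forall d, {in porbit p d, forall d', g (p d') = g d'} ->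
  {in porbit p d, forall d', g d' = g d}.
Proof.
move=> d gp _ /porbitP[i ->]; elim: i => [|i IHi]; first by rewrite perm1.
by rewrite expgSr permM gp ?mem_porbit.
Qed.

Lemma adj_mapP (x y : V) :
  reflect (exists2 d, tail d = x & tail (rev M d) = y)
          (adj (x : vertex (map_graph M)) y).
Proof.
apply: (iffP existsP) => [[A /eqP /= eA]|[d <- <-]]; last first.
  by exists (edge_of d); rewrite /= map_ends_edge_of.
have [d dA] := edge_of_surj A; move: eA; rewrite dA map_ends_edge_of => eA.
have := set21 x y; have := set22 x y; rewrite -eA !inE.
have := set21 (tail d) (tail (rev M d)); rewrite eA !inE.
have := set22 (tail d) (tail (rev M d)); rewrite eA !inE.
have nd := tail_rev d.
move=> t2 t1 ey /orP[] /eqP xd; [exists d | exists (rev M d)] => //.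
  move: ey t2; rewrite xd => /orP[/eqP ->|/eqP-> //].
  by rewrite orbb => /eqP e; rewrite e eqxx in nd.
rewrite revK; move: ey t1; rewrite xd orbC => /orP[/eqP ->|/eqP-> //].
by rewrite orbb => /eqP e; rewrite -e eqxx in nd.
Qed.

Hypothesis connM : forall x y : vertex (map_graph M), connect (adj_minus set0) x y.
Hypothesis darts_at : forall v : V, exists d : dart M, tail d = v.

Lemma vertex_invariant T (g : V -> T) :
  (forall d : dart M, g (tail (rev M d)) = g (tail d)) -> forall x y, g x = g y.
Proof.
move=> gr x y; have /connectP[p + ->] := connM x y.
elim: p x => //= z p IHp x /andP[/and3P[_ _ /adj_mapP[d <- <-]] /IHp <-].
by rewrite gr.
Qed.

(** In a connected map [rev] and [nxt] act transitively on darts: [nxt] turns around a vertex and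
    [rev] moves along an edge. *)
Lemma dart_invariant T (g : dart M -> T) :
  (forall d, g (rev M d) = g d) -> (forall d, g (nxt M d) = g d) ->
  forall d d', g d = g d'.
Proof.
move=> gr gn d d'.
have g_tail (d1 d2 : dart M) : tail d1 = tail d2 -> g d1 = g d2.
  by move=> /eqP; rewrite tail_nxt => /(orbit_invariant (in1W gn)) ->.
have /connectP[p] := connM (tail d) (tail d').
elim: p d => [|z p IHp] d /=; first by move=> _ /g_tail.
case/andP=> /and3P[_ _ /adj_mapP[d1 d1d <-]] /IHp /[apply] <-.
by rewrite gr; exact/g_tail.
Qed.

(** * Edge colourings, their boundaries, and the even subgraphs of the radial graph *)

Definition dart_edge_row (u : 'rV[bool]_#|map_edge M|) (d : dart M) : bool :=
  u ord0 (enum_rank (edge_of d)).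

Lemma dart_edge_row_rev u d : dart_edge_row u (rev M d) = dart_edge_row u d.
Proof. by rewrite /dart_edge_row edge_of_rev. Qed.

(** As a linear map, it sends a 2-colouring of the edges to the set of angles where the colour
    changes. *)
Definition boundary_mx : 'M[bool]_(#|map_edge M|, #|dart M|) :=
  \matrix_(i < #|map_edge M|, j < #|dart M|) ((enum_val j \in val (enum_val i))
                  (+) (nxt M (enum_val j) \in val (enum_val i))).

(** Radial edges index the rows, so the left kernel is the cycle space of the radial graph. *)
Definition incidence_mx : 'M[bool]_(#|dart M|, #|radial_vertex M|) :=
  \matrix_(j < #|dart M|, i < #|radial_vertex M|)
    (enum_val i \in radial_ends (inr (enum_val j))).

Lemma mul_boundary_mx u (j : 'I_#|dart M|) :
  (u *m boundary_mx)%R ord0 j =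
  dart_edge_row u (enum_val j) (+) dart_edge_row u (nxt M (enum_val j)).
Proof.
have sumE d : (\sum_(i < #|map_edge M|) u ord0 i * (d \in val (enum_val i)))%R
              = dart_edge_row u d.
  rewrite (bigD1 (enum_rank (edge_of d))) //= edge_ofE enum_rankK eqxx mulr1.
  rewrite big1 ?addr0 // => i; rewrite edge_ofE => /negbTE ni.
  case: eqP => [e|_]; last by rewrite mulr0.
  by rewrite -e enum_valK eqxx in ni.
rewrite mxE -!sumE -[RHS]big_split /=.
by apply: eq_bigr => i _; rewrite mxE -[RHS]mulrDr.
Qed.

(** A colouring without any change is invariant under [rev] and [nxt], hence constant. *)
Lemma rank_boundary_mx : #|map_edge M|.-1 <= \rank boundary_mx.
Proof.
apply: rank_kermx_const => u uB0.
have un d : dart_edge_row u (nxt M d) = dart_edge_row u d.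
  have := congr1 (fun A : 'rV_ _ => A ord0 (enum_rank d)) uB0.
  by rewrite mul_boundary_mx mxE enum_rankK; do 2!case: dart_edge_row.
move=> i j; have [d ed] := edge_of_surj (enum_val i).
have [d' ed'] := edge_of_surj (enum_val j).
have := dart_invariant (@dart_edge_row_rev u) un d d'.
by rewrite /dart_edge_row -ed -ed' !enum_valK.
Qed.

(** A function killed by the transpose takes equal values at the two ends of each radial edge; it is
    constant because the radial graph is connected. *)
Lemma rank_incidence_mx : #|radial_vertex M|.-1 <= \rank incidence_mx.
Proof.
rewrite -mxrank_tr; apply: rank_kermx_const => u uI0.
pose b w := u ord0 (enum_rank w).
have bE d : b (inl (tail d)) = b (inr (angle_face d)).
  have := congr1 (fun A : 'rV_ _ => A ord0 (enum_rank d)) uI0.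
  rewrite !mxE (bigD1 (enum_rank (inl (tail d) : radial_vertex M))) //=.
  rewrite (bigD1 (enum_rank (inr (angle_face d) : radial_vertex M))) //=; last first.
    by rewrite (inj_eq enum_rank_inj).
  rewrite big1 ?addr0 => [|i /andP[ni1 ni2]].
    rewrite !mxE !enum_rankK !inE !eqxx ?orbT !mulr1 -/(b _) -/(b _).
    by do 2!case: (b _).
  rewrite !mxE !enum_rankK !inE -(inj_eq enum_rank_inj) enum_valK (negbTE ni1).
  by rewrite -(inj_eq enum_rank_inj) enum_valK (negbTE ni2) mulr0.
have bV : forall x y : V, b (inl x) = b (inl y).
  (* Both ends of [d] are on the face of the angle that precedes [d] in the rotation at its tail. *)
  apply: vertex_invariant => d.
  rewrite -{2}[d](permKV (nxt M)) bE tail_nxt_eq.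
  by rewrite -[in LHS](permKV (nxt M) d) angle_face_next -bE.
have bT w : exists d : dart M, b w = b (inl (tail d)).
  case: w => [v|[[A Ap]|[v]]].
  - by have [d <-] := darts_at v; exists d.
  - have /imsetP[d _ eA] := Ap; exists d; rewrite bE; congr (b (inr (inl _))).
    exact: val_inj.
  (* The face of an isolated vertex is excluded by [darts_at]. *)
  - have [d dv] := darts_at v => nv; exfalso; move: nv.
    by rewrite -dv codom_f.
move=> i j; have [d ei] := bT (enum_val i); have [d' ej] := bT (enum_val j).
by move: (bV (tail d) (tail d')); rewrite -ei -ej /b !enum_valK.
Qed.

Lemma card_components :
  dart M -> #|components (set0 : {set vertex (map_graph M)})| = 1.
Proof.
move=> d0; apply/eqP/cards1P; exists setT; apply/setP => A; rewrite !inE.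
apply/imsetP/eqP => [[x _ ->]|->]; last exists (tail d0); rewrite ?inE //.
  by apply/setP => y; rewrite !inE connM.
by apply/setP => y; rewrite !inE connM.
Qed.

Definition even_darts (z : pred (dart M)) : Prop :=
  forall w : radial_vertex M,
    \big[addb/false]_d (z d && (w \in radial_ends (inr d))) = false.

Definition boundary (chi : dart M -> bool) (d : dart M) : bool :=
  chi d (+) chi (nxt M d).

(** The angles at a vertex are permuted by [nxt], those of a face by [nxt * rev]. For such a
    permutation [p] the boundary at [d] is [chi d + chi (p d)], and reindexing by [p] cancels the
    two sums. *)
Lemma boundary_even (chi : dart M -> bool) :
  (forall d, chi (rev M d) = chi d) -> even_darts (boundary chi).
Proof.
move=> chir w.
have [p tp chip] : exists2 p : {perm dart M},
    forall d, (w \in radial_ends (inr (p d))) = (w \in radial_ends (inr d))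
    & forall d, chi (p d) = chi (nxt M d).
  case: w => [v|f]; [exists (nxt M) => // | exists (nxt M * rev M)%g] => d.
  - by rewrite !inE !orbF tail_nxt_eq.
  - by rewrite !inE permM angle_face_next.
  - by rewrite permM chir.
under eq_bigr => d _ do rewrite andb_addl -{2}tp -chip.
rewrite big_split /= [X in _ (+) X](reindex_inj (@perm_inj _ p^-1%g)) /=.
by under [X in _ (+) X]eq_bigr => d _ do rewrite permKV; rewrite addbb.
Qed.

Lemma card_dart : #|dart M| = 2 * #|map_edge M|.
Proof.
rewrite -sum1_card (partition_big edge_of predT) //= mulnC -sum_nat_const.
apply: eq_bigr => A _; rewrite sum1_card.
have [d ->] := edge_of_surj A.
have <- : #|[set d; rev M d]| = 2.
  rewrite cards2; case: eqP => // e.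
  by have := tail_rev d; rewrite -e eqxx.
apply: eq_card => d'; rewrite [LHS]unfold_in !inE [LHS]eq_sym -[LHS]edge_ofE.
by apply/edge_ofP/orP => -[/eqP|/eqP]; auto.
Qed.

Lemma sum_enum_dart (F : dart M -> bool) :
  (\sum_(j < #|dart M|) F (enum_val j))%R = \big[addb/false]_d F d.
Proof. by rewrite [RHS](reindex _ (onW_bij _ (@enum_val_bij _))). Qed.

Hypothesis planarM : planar M.

(** Boundaries are even by [boundary_even], and they have dimension at least [E - 1]. The even sets
    have dimension at most [2E - (V + F - 1)], which Euler's formula for a connected map turns into
    [E - 1]; so the two spaces coincide. *)
Lemma even_boundary (z : pred (dart M)) : even_darts z ->
  exists2 chi : dart M -> bool,
    forall d, chi (rev M d) = chi d & forall d, z d = boundary chi d.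
Proof.
move=> evz; have [d0 _|nod] := pickP (dart M); last first.
  by exists xpred0 => [//|d]; have := nod d.
have sub : (boundary_mx <= kermx incidence_mx)%MS.
  apply/sub_kermxP/matrixP => i w; rewrite !mxE.
  pose chi := fun d => d \in val (enum_val i).
  have chir d : chi (rev M d) = chi d by rewrite /chi !edge_ofE edge_of_rev.
  rewrite -[RHS](boundary_even chir (enum_val w)) -sum_enum_dart.
  by apply: eq_bigr => j _; rewrite !mxE.
have ker_sub : (kermx incidence_mx <= boundary_mx)%MS.
  rewrite -(geq_leqif (mxrank_leqif_sup sub)) mxrank_ker.
  apply: leq_trans rank_boundary_mx.
  have := rank_incidence_mx; have := planarM; move: (\rank _) => r.
  by rewrite card_dart /planar card_components // -card_sum => ->; lia.
pose r := (\row_(j < #|dart M|) z (enum_val j))%R.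
have : (r <= kermx incidence_mx)%MS.
  apply/sub_kermxP/rowP => w; rewrite !mxE.
  rewrite -[RHS](evz (enum_val w)) -sum_enum_dart.
  by apply: eq_bigr => j _; rewrite !mxE.
case/submx_trans/(_ ker_sub)/submxP => u ru.
exists (dart_edge_row u) => d; first exact: dart_edge_row_rev.
have := congr1 (fun A : 'rV_ _ => A ord0 (enum_rank d)) ru.
by rewrite mul_boundary_mx mxE enum_rankK.
Qed.

(** * Cycles of the radial graph and their two sides *)

Definition cycle_darts
    (c : seq (vertex (with_radial M) * edge (with_radial M))) : pred (dart M) :=
  fun d => inr d \in [seq p.2 | p <- c].

(** The edges of a cycle are distinct, so the sum over its positions in [cycle_even] is a sum over
    darts. *)
Lemma cycle_darts_even (c : seq (vertex (with_radial M) * edge (with_radial M))) :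
  is_cycle c -> (forall p, p \in c -> exists d, p.2 = inr d) ->
  even_darts (cycle_darts c).
Proof.
move=> cyc cd w; rewrite -[RHS](cycle_even (w : vertex (with_radial M)) cyc).
have [_ _ _ uc] := cyc.
rewrite -(big_map snd predT (fun e => (w : vertex (with_radial M)) \in ends e)).
rewrite [RHS]big_uniq // [RHS]big_mkcond [RHS]big_sumType /=.
rewrite [X in _ = X (+) _]big1 => [|A _].
  by apply: eq_bigr => d _; rewrite /cycle_darts; case: (_ \in map _ _).
by case: ifP => // /mapP[p /cd[d ->]].
Qed.

(* Any cycle inside the boundary of [chi] bounds by planarity; subtracting it
   from [chi] shrinks the boundary, and one of these cycles must distinguish
   [d1] from [d2]. *)
Lemma boundary_cycle_separates (chi : dart M -> bool) (d1 d2 : dart M) :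
  (forall d, chi (rev M d) = chi d) -> chi d1 != chi d2 ->
  exists2 c : seq (vertex (with_radial M) * edge (with_radial M)),
    is_cycle c /\ (forall p, p \in c -> exists2 d, p.2 = inr d & boundary chi d)
    & exists phi : dart M -> bool,
        [/\ forall d, phi (rev M d) = phi d, phi d1 != phi d2
          & forall d, boundary phi d = cycle_darts c d].
Proof.
elim: {chi}_.+1 {-2}chi (ltnSn #|boundary chi|) => // n IHn chi chin chir chi12.
pose z (e : edge (with_radial M)) := if e is inr d then boundary chi d else false.
have [||c cyc cz] := @exists_cycle (with_radial M) z.
(* Degrees in the boundary are even, so one of its edges at [w] forces another. *)
- move=> w [//|d] /= zd wd; have := boundary_even chir w.
  rewrite (bigD1 d) //= zd wd => /negbFE sum1.
  have /existsP[d' /andP[nd' /andP[zd' wd']]] :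
      [exists d', (d' != d) && (boundary chi d' && (w \in radial_ends (inr d')))].
    apply: contraLR sum1; rewrite negb_exists => /forallP no.
    by rewrite big1 // => d' nd'; have := no d'; rewrite nd' => /negbTE.
  by exists (inr d').
- have [d zd|no] := pickP (boundary chi); first by exists (inr d).
  (* With an empty boundary [chi] would be constant. *)
  have chin' d : chi (nxt M d) = chi d.
    by have := no d; rewrite /boundary; do 2!case: (chi _).
  by rewrite (dart_invariant chir chin' d1 d2) eqxx in chi12.
have cd p : p \in c -> exists2 d, p.2 = inr d & boundary chi d.
  by move=> /cz; case: p.2 => // d zd; exists d.
have [phi phir phic] : exists2 phi : dart M -> bool,
    forall d, phi (rev M d) = phi d & forall d, cycle_darts c d = boundary phi d.
  by apply/even_boundary/cycle_darts_even => // p /cd[d]; exists d.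
have [phi12|phi12] := eqVneq (phi d1) (phi d2); last first.
  by exists c => //; exists phi; split.
(* Since [phi] agrees on [d1] and [d2], [chi'] still distinguishes them, while its boundary loses
   the edges of [c]. *)
pose chi' d := chi d (+) phi d.
have chi'E d : boundary chi' d = boundary chi d (+) cycle_darts c d.
  by rewrite phic /boundary /chi' addbACA.
have cycle_chi d : cycle_darts c d -> boundary chi d.
  by case/mapP=> p /cd[d' -> zd'] [->].
have chi'S d : boundary chi' d -> boundary chi d.
  by rewrite chi'E; have := @cycle_chi d; case: boundary => //; case: cycle_darts => // ->.
have [|||c' [cyc' c'd] H] := IHn chi'.
- rewrite ltnS in chin; apply: leq_trans chin; apply: proper_card.
  apply/properP; split; first by apply/subsetP => d; apply: chi'S.
  case: (cyc) => + _ _ _; case: (c) cd cycle_chi chi'E {cyc} => //.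
  move=> p s cd cycle_chi chi'E _.
  have [d pd zd] := cd p (mem_head _ _); exists d; first exact: zd.
  by rewrite -topredE /= chi'E zd /cycle_darts /= -pd mem_head.
- by move=> d; rewrite /chi' chir phir.
- by rewrite /chi' phi12 (inj_eq (@addIb _)).
exists c' => //; split=> // p /c'd[d pd /chi'S]; by exists d.
Qed.

Lemma cycle_darts_mem
    (c : seq (vertex (with_radial M) * edge (with_radial M))) d w :
  is_cycle c -> cycle_darts c d -> w \in radial_ends (inr d) ->
  w \in cycle_vertices c.
Proof.
by move=> cyc /mapP[p pc pd] wd; apply: (cycle_end_mem cyc pc); rewrite -pd.
Qed.

(** Around a vertex or a face off the cycle [phi] never changes, so it colours everything off the
    cycle, and a path avoiding the cycle keeps its colour. *)
Lemma cycle_separates (c : seq (vertex (with_radial M) * edge (with_radial M)))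
    (phi : dart M -> bool) (d1 d2 : dart M) :
  is_cycle c ->
  (forall d, phi (rev M d) = phi d) ->
  (forall d, boundary phi d = cycle_darts c d) ->
  phi d1 != phi d2 ->
  inl (tail d1) \notin cycle_vertices c ->
  ~~ connect (adj_minus (cycle_vertices c)) (inl (tail d1)) (inl (tail d2)).
Proof.
move=> cyc phir phic phi12 c1.
pose col (w : vertex (with_radial M)) b :=
  forall d, w \in radial_ends (inr d) -> phi d = b.
have phin d w : w \notin cycle_vertices c -> w \in radial_ends (inr d) ->
    phi (nxt M d) = phi d.
  move=> wc wd; have := phic d; rewrite /boundary.
  have /negbTE -> : ~~ cycle_darts c d by apply: contraNN wc => /cycle_darts_mem ->.
  by do 2!case: (phi _).
have colE d w :
    w \notin cycle_vertices c -> w \in radial_ends (inr d) -> col w (phi d).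
  move=> wc wd d'; case: w wc wd => [v|f] wc.
    rewrite !inE !orbF !(inj_eq (@inl_inj _ _)) => /eqP vd /eqP vd'.
    apply: (@orbit_invariant _ (nxt M)); last by rewrite -tail_nxt -vd vd'.
    move=> d3; rewrite -tail_nxt -vd => /eqP vd3; apply: phin wc _.
    by rewrite !inE vd3 eqxx.
  rewrite !inE /= !(inj_eq (@inr_inj _ _)) => /eqP fd /eqP fd'.
  have fE d3 : (f == angle_face d3) = (d3 \in porbit (nxt M * rev M)%g d).
    by rewrite fd (inj_eq (@inl_inj _ _)) -val_eqE /= eq_porbit_mem porbit_sym.
  apply: (@orbit_invariant _ (nxt M * rev M)%g); last by rewrite -fE fd'.
  move=> d3; rewrite -fE => /eqP fd3; rewrite permM phir; apply: phin wc _.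
  by rewrite !inE fd3 eqxx.
(* The ends of an edge share a colour: the two darts of a map edge agree by [phir], and a radial
   edge is a single angle seen from both ends. *)
have edge_col (e : edge (with_radial M)) :
    exists b, forall w, w \in ends e -> exists2 d, w \in radial_ends (inr d) & phi d = b.
  case: e => [A|d]; last by exists (phi d) => w wd; exists d.
  have [d ->] := edge_of_surj A; exists (phi d) => w /imsetP[v].
  rewrite map_ends_edge_of => /set2P[] -> ->; [exists d | exists (rev M d)] => //.
  - exact: set21.
  - exact: set21.
apply/negP => /connectP[p].
have : col (inl (tail d1)) (phi d1) by apply: colE => //; apply: set21.
elim: p (inl (tail d1) : vertex (with_radial M)) => [|w' p IHp] w colw /=.
  by move=> _ e; move: phi12; rewrite -(colw d2) ?eqxx // -e set21.
case/andP=> /and3P[wc wc' /existsP[e /eqP ee]]; apply: IHp.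
have [b eb] := edge_col e.
have [|d wd db] := eb w; first by rewrite ee set21.
have [|d' wd' db'] := eb w'; first by rewrite ee set22.
by rewrite -(colw d wd) db -db'; apply: colE.
Qed.

End Jordan.
(** * Drawings with at most one crossing per edge *)

Lemma connect_map (H : mgraph) (S : {set vertex H}) (T : finType) (r : rel T)
    (f : vertex H -> T) :
  {in ~: S &, forall u w, adj u w -> connect r (f u) (f w)} ->
  forall u w, connect (adj_minus S) u w -> connect r (f u) (f w).
Proof.
move=> fr u w /connectP[p + ->]; elim: p u => //= v p IHp u.
case/andP=> /and3P[uS vS uv] /IHp; apply: connect_trans.
by apply: fr => //; rewrite inE.
Qed.

Section OnePlanar.
Variables (G : mgraph) (D : one_planar_drawing G).
Local Notation M := (planarisation D).
Local Notation Lambda := (radial_planarisation D).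
Implicit Types (u v w : vertex G) (x y : crossing D) (d : dart M).

Lemma seg_end d u : tail d = inl u -> u \in ends (seg d).
Proof.
move=> du; have : 0 < #|[set d' : dart M | (seg d' == seg d) && (tail d' == inl u)]|.
  by apply/card_gt0P; exists d; rewrite inE du !eqxx.
by rewrite seg_ends; case: (_ \in _).
Qed.

Lemma seg_dart (e : edge G) u :
  u \in ends e -> exists2 d : dart M, tail d = inl u & seg d = e.
Proof.
move=> ue.
have /card_gt0P[d] : 0 < #|[set d : dart M | (seg d == e) && (tail d == inl u)]|.
  by rewrite seg_ends ue.
by rewrite inE => /andP[/eqP <- /eqP]; exists d.
Qed.

Lemma crossing_dart x : exists d : dart M, tail d = inr x.
Proof.
have /card_gt0P[d] : 0 < #|[set d : dart M | tail d == inr x]|.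
  by rewrite crossing_degree.
by rewrite inE => /eqP; exists d.
Qed.

Local Notation adjM a b := (adj (a : vertex (map_graph M)) b).

Lemma dart_adj d : adjM (tail d) (tail (rev M d)).
Proof. by apply/adj_mapP; exists d. Qed.

(** Follow the edge from both ends: each first segment reaches the other end or a crossing, and two
    such crossings are equal by [crossed_once]. *)
Lemma adj_planarisation u w : adj u w ->
  adjM (inl u) (inl w) \/ exists x, adjM (inl u) (inr x) /\ adjM (inr x) (inl w).
Proof.
case/existsP=> e /eqP ee; have uw := ends_neq ee.
have [d du de] : exists2 d : dart M, tail d = inl u & seg d = e.
  by apply: seg_dart; rewrite ee set21.
have [d' dw de'] : exists2 d : dart M, tail d = inl w & seg d = e.
  by apply: seg_dart; rewrite ee set22.
have := dart_adj d; have := dart_adj d'; rewrite du dw.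
have rd := tail_rev d; have rd' := tail_rev d'; rewrite du dw in rd rd'.
case du': (tail (rev M d)) rd => [v|x] rd.
  have := seg_end du'; rewrite seg_rev de ee => /set2P[vu|->]; last by left.
  by rewrite vu eqxx in rd.
case dw': (tail (rev M d')) rd' => [v|y] rd'.
  have := seg_end dw'; rewrite seg_rev de' ee => /set2P[->|vw].
    by rewrite adj_sym; left.
  by rewrite vw eqxx in rd'.
have <- : x = y by apply: crossed_once du' dw'; rewrite !seg_rev de.
by rewrite adj_sym => xw ux; right; exists x.
Qed.

Lemma planarisation_connected :
  connected G -> forall a b : vertex (map_graph M), connect (adj_minus set0) a b.
Proof.
move=> connG.
have cadj (a b : vertex (map_graph M)) : adj a b -> connect (adj_minus set0) a b.
  by move=> ab; apply: connect1; rewrite /adj_minus /= !inE.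
have creal u w : connect (adj_minus set0) (inl u : vertex (map_graph M)) (inl w).
  apply: (connect_map (f := inl)) (connectedP connG u w) => {}u {}w _ _ uw.
  have [/cadj //|[x [/cadj ux /cadj xw]]] := adj_planarisation uw.
  exact: connect_trans ux xw.
have toreal (a : vertex (map_graph M)) : exists u, connect (adj_minus set0) a (inl u).
  case: a => [u|x]; first by exists u; apply: connect0.
  have [d dx] := crossing_dart x; have := dart_adj d; have := tail_rev d.
  rewrite dx; case dx': (tail (rev M d)) => [u|y]; first by move=> _ /cadj; exists u.
  (* A segment between two crossings would belong to an edge crossed twice, or be a loop. *)
  move=> /eqP[]; congr inr; apply: crossed_once dx' dx; exact: seg_rev.
move=> a b; have [u au] := toreal a; have [w bw] := toreal b.
apply: connect_trans au _; apply: connect_trans (creal u w) _.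
by rewrite connect_adj_minus_sym.
Qed.

(** This provides the hypothesis [darts_at] of the planar map results; vertices in two different
    flaps will serve as [u] and [w]. *)
Lemma no_isolated_vertex u w :
  connected G -> u != w ->
  forall a : (vertex G + crossing D)%type, exists d : dart M, tail d = a.
Proof.
move=> connG nuw [v|x]; last exact: crossing_dart.
have [v' nv] : exists v', v != v'.
  by have [->|] := eqVneq v u; [exists w | exists u].
have /connectP[[|v1 p] /=] := connectedP connG v v'.
  by move=> _ e; rewrite e eqxx in nv.
case/andP=> /and3P[_ _ /existsP[e /eqP ee]] _ _.
by have [|d dv _] := @seg_dart e v; [rewrite ee set21 | exists d].
Qed.

Lemma adj_radial (a b : vertex (map_graph M)) :
  adj a b -> adj (inl a : vertex Lambda) (inl b).
Proof.
case/existsP=> A /eqP eA; apply/existsP; exists (inl A) => /=.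
by rewrite [map_ends A]eA imsetU !imset_set1.
Qed.

(** * From a constrained separating cycle to a separating set *)

Lemma connect_real_vertex (S : {set vertex G}) (X : {set vertex Lambda}) u w :
  (forall v, v \notin S -> real_vertex D v \notin X) ->
  (forall x, dummy_vertex x \notin X) ->
  connect (adj_minus S) u w ->
  connect (adj_minus X) (real_vertex D u) (real_vertex D w).
Proof.
move=> SX Xdummy; apply: connect_map => {}u {}w; rewrite !inE => /SX uX /SX wX uw.
have [uw'|[x [ux xw]]] := adj_planarisation uw.
  by apply: connect1; rewrite /adj_minus /= uX wX; apply: adj_radial.
apply: (@connect_trans _ _ (dummy_vertex x)); apply: connect1.
  by rewrite /adj_minus /= uX Xdummy; apply: adj_radial.
by rewrite /adj_minus /= wX Xdummy; apply: adj_radial.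
Qed.

(** The radial graph is bipartite between the vertices of the planarisation and the faces, so half
    of the cycle is on the vertex side, where only real vertices occur. *)
Lemma radial_cycle_size (c : seq (vertex Lambda * edge Lambda)) :
  is_cycle c -> (forall p, p \in c -> exists a, p.2 = angle_edge a) ->
  (forall x, dummy_vertex x \notin cycle_vertices c) ->
  size c = 2 * #|[set v | real_vertex D v \in cycle_vertices c]|.
Proof.
move=> [_ cc uc _] ca Xdummy.
pose P (p : vertex Lambda * edge Lambda) := if p.1 is inl _ then true else false.
rewrite (@size_cycle_alternate _ _ P _ _ cc); last first.
  move=> p /ca[d pd] q; rewrite pd /= /P => /eqP pq.
  have := set21 p.1 q.1; have := set22 p.1 q.1; rewrite -pq !inE.
  have := ends_neq (e := inr d : edge Lambda) pq.
  by case: (p.1) (q.1) => [a|f] [b|g] //= /eqP nab; rewrite ?orbF => /eqP e /eqP e';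
     case: nab; rewrite e e'.
congr (2 * _); rewrite -(card_imset _ (f := real_vertex D)); last by move=> v w [].
rewrite -size_filter -(size_map fst) -(card_uniqP _); last first.
  by rewrite (subseq_uniq _ uc) // map_subseq // filter_subseq.
apply: eq_card => a; apply/mapP/imsetP => [[p]|[v]].
  rewrite mem_filter => /andP[Pp pc] ap; have := map_f fst pc; rewrite -ap => ac.
  move: Pp; rewrite /P -ap; case: a ac {ap} => // -[v|x] ac _.
    by exists v; rewrite // !inE.
  by have := Xdummy x; rewrite inE ac.
rewrite !inE => /mapP[p pc vp] ->; exists p => //.
by rewrite mem_filter pc andbT /P -vp.
Qed.

Lemma separating_of_cycle (c : seq (vertex Lambda * edge Lambda)) :
  constrained_separating_cycle c ->
  exists2 S : {set vertex G}, separating S & 2 * #|S| = size c.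
Proof.
move=> [cyc /components_gt1[a [b [[aX bX nab]]]] sep1 sep2 ca Xdummy].
pose X := cycle_vertices c; pose S := [set v | real_vertex D v \in X].
exists S; last by rewrite -radial_cycle_size.
move: sep1 sep2 => /existsP[u]; rewrite inE => au /existsP[w]; rewrite inE => bw.
(* The real vertices [u] and [w] replace the representatives [a] and [b]; lying in components of the
   complement, they are off the cycle. *)
have Xend (v v' : vertex Lambda) :
    v \notin X -> connect (adj_minus X) v v' -> v' \notin X.
  move=> vX /connectP[p + ->]; elim: p v vX => //= v1 p IHp v vX.
  by case/andP => /and3P[_ v1X _]; apply: IHp.
apply/separatingP; exists u, w; split; rewrite 1?inE;
  [exact: Xend aX au | exact: Xend bX bw |].
apply: contraNN nab => uw; apply: connect_trans au _.
rewrite connect_adj_minus_sym; apply: connect_trans bw _.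
rewrite connect_adj_minus_sym; apply: connect_real_vertex uw => // v.
by rewrite inE.
Qed.

(** * From a separating set to a constrained separating cycle *)

Hypothesis connG : connected G.
Hypothesis maxD : locally_maximal D.

Lemma crossing_ends_adj d d' x u w :
  tail d = inr x -> tail d' = inr x -> u \in ends (seg d) -> w \in ends (seg d') ->
  u != w -> adj u w.
Proof.
move=> dx dx' ud wd uw; have [e|ne] := eqVneq (seg d) (seg d').
  by apply/existsP; exists (seg d); rewrite (ends_pair ud _ uw) // e.
apply: (maxD (e := seg d) (f := seg d')); rewrite ?inE ?ud ?wd ?orbT //.
by split=> //; exists x; split; [exists d | exists d'].
Qed.

Section Separation.
Variables (S A : {set vertex G}).
Hypothesis closedA : forall u w, u \in A -> w \notin S -> adj u w -> w \in A.

(* The union of flaps [A] spreads to the crossings whose edges have an end in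
   [A]; local maximality makes this compatible with the other flaps. *)
Definition flap_side (a : (vertex G + crossing D)%type) : bool :=
  match a with
  | inl u => u \in A
  | inr x => [exists d : dart M,
      (tail d == inr x) && [exists u in A, u \in ends (seg d)]]
  end.

(** One end on the side suffices for an edge to be coloured, so no colour change occurs around a
    vertex of the side. *)
Definition flap_colour d : bool := flap_side (tail d) || flap_side (tail (rev M d)).

Lemma flap_colour_rev d : flap_colour (rev M d) = flap_colour d.
Proof. by rewrite /flap_colour revK orbC. Qed.

(** A real vertex off [S] next to a crossing of an edge with an end in [A] is equal or, by local
    maximality, adjacent to that end, so it is in [A]. A crossing next to a vertex of [A] is on the
    side by definition, and no segment joins two crossings. *)
Lemma flap_side_rev d :
  (forall u, tail d = inl u -> u \notin S) -> ~~ flap_side (tail d) ->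
  ~~ flap_side (tail (rev M d)).
Proof.
case dt: (tail d) => [u|x] dS; last case dt': (tail (rev M d)) => [w|y].
- have uS : u \notin S by apply: dS.
  have ud := seg_end dt; move=> uA; apply/negP.
  case dt': (tail (rev M d)) => [w|x] /=.
    move=> wA; have wd := seg_end dt'; rewrite seg_rev in wd.
    have wu : w != u by apply: contraNneq uA => <-.
    case/negP: uA; apply: closedA wA uS _; apply/existsP; exists (seg d).
    by rewrite (ends_pair wd ud wu).
  case/existsP=> d' /andP[/eqP dx' /existsP[w /andP[wA wd']]].
  have wu : w != u by apply: contraNneq uA => <-.
  case/negP: uA; apply: closedA wA uS _.
  by apply: (crossing_ends_adj dx' dt') wu; rewrite ?seg_rev.
- move=> xA; apply: contraNN xA => /= wA; apply/existsP; exists d.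
  rewrite dt eqxx; apply/existsP; exists w; rewrite wA.
  by rewrite -seg_rev (seg_end dt').
- have xy : x = y by apply: crossed_once dt dt'; rewrite seg_rev.
  by have := tail_rev d; rewrite dt dt' xy eqxx.
Qed.

(** Around a vertex of the side all edges are coloured; around any other vertex not in [S],
    crossings included, none is, by [flap_side_rev]. *)
Lemma flap_colour_boundary d :
  boundary flap_colour d -> exists2 s, s \in S & tail d = inl s.
Proof.
case: (pickP [pred s in S | tail d == inl s]) => [s /andP[sS /eqP ds] _|no].
  by exists s.
have dS d' : tail d' = tail d -> forall u, tail d' = inl u -> u \notin S.
  by move=> -> u du; have := no u; rewrite /= du eqxx andbT => ->.
rewrite /boundary /flap_colour tail_nxt_eq.
case side: (flap_side (tail d)) => //=.
have /negbTE -> : ~~ flap_side (tail (rev M d)).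
  by apply: flap_side_rev; [apply: dS | rewrite side].
have /negbTE -> // : ~~ flap_side (tail (rev M (nxt M d))).
by apply: flap_side_rev; [apply: dS | rewrite ?side]; rewrite tail_nxt_eq ?side.
Qed.

End Separation.

Lemma cycle_of_separating (S : {set vertex G}) :
  separating S ->
  exists2 c : seq (vertex Lambda * edge Lambda),
    constrained_separating_cycle c & size c <= 2 * #|S|.
Proof.
case/separatingP=> u [w [uS wS nuw]].
pose A := [set v | connect (adj_minus S) u v].
have notS v : v \in A -> v \notin S.
  rewrite inE => /connectP[p + ->]; elim: p u uS {nuw A} => //= v1 p IHp v0 _.
  by case/andP=> /and3P[_ v1S _]; apply: IHp.
have closedA v v' : v \in A -> v' \notin S -> adj v v' -> v' \in A.
  move=> vA v'S vv'; rewrite inE; move: (vA); rewrite inE => /connect_trans; apply.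
  by apply: connect1; rewrite /adj_minus /= notS ?v'S.
have uA : u \in A by rewrite inE connect0.
have wA : w \notin A by rewrite inE.
have nuw' : u != w by apply: contraNneq wA => <-.
have darts_at := no_isolated_vertex connG nuw'.
have connM := planarisation_connected connG.
have [du du_u] := darts_at (inl u); have [dw dw_w] := darts_at (inl w).
have colu : flap_colour A du by rewrite /flap_colour du_u /= uA.
have colw : ~~ flap_colour A dw.
  rewrite negb_or; apply/andP; split; first by rewrite dw_w.
  by apply: (flap_side_rev closedA); rewrite dw_w // => _ [<-].
have [|c [cyc cb] [phi [phir phi12 phic]]] := boundary_cycle_separates connM darts_at
    (planarisation_planar D) (@flap_colour_rev A) (d1 := du) (d2 := dw).
  by rewrite colu (negbTE colw).
(* The cycle consists of angles where the colour changes, so apart from faces it meets only [S].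
   This bounds its length, excludes dummy vertices and keeps [u] and [w] off it. *)
have cS a : inl a \in cycle_vertices c -> exists2 s, s \in S & a = inl s.
  rewrite inE => /mapP[p pc pa].
  have [_ cc _ _] := cyc; have /eqP pe := next_cycle cc pc.
  have [d pd /(flap_colour_boundary closedA)[s sS ds]] := cb p pc.
  have := set21 p.1 (next c p).1; rewrite -pe pd -pa !inE orbF => /eqP[->].
  by exists s.
have notc v : v \notin S -> real_vertex D v \notin cycle_vertices c.
  by apply: contraNN => /cS[s sS [->]].
have Xdummy x : dummy_vertex x \notin cycle_vertices c by apply/negP => /cS[].
have ca p : p \in c -> exists a, p.2 = angle_edge a.
  by case/cb=> d pd _; exists d.
exists c; last first.
  rewrite (radial_cycle_size cyc ca Xdummy) leq_mul2l subset_leq_card //.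
  by apply/subsetP => v; rewrite inE => /cS[s sS [->]].
split=> //; apply/components_gt1; exists (real_vertex D u), (real_vertex D w); split.
- split; [exact: notc | exact: notc |].
  have := cycle_separates cyc phir phic phi12; rewrite du_u dw_w; apply.
  exact: notc.
- by apply/existsP; exists u; rewrite inE connect0.
- by apply/existsP; exists w; rewrite inE connect0.
Qed.

End OnePlanar.

Theorem theorem1 (G : mgraph) (D : one_planar_drawing G) (k : nat) :
  connected G -> locally_maximal D -> 0 < k ->
  (exists S : {set vertex G}, separating S /\ #|S| <= k) <->
  (exists c : seq (vertex (radial_planarisation D)
                   * edge (radial_planarisation D)),
      constrained_separating_cycle c /\ size c <= 2 * k).
Proof.
move=> connG maxD _; split=> [[S [sepS Sk]]|[c [sepc ck]]].
  have [c sepc cS] := cycle_of_separating connG maxD sepS.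
  by exists c; split=> //; apply: leq_trans cS _; rewrite leq_mul2l.
have [S sepS Sc] := separating_of_cycle sepc.
by exists S; split=> //; rewrite -(leq_pmul2l (ltn0Sn 1)) Sc.
Qed.
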